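(* Let $p$ be a prime, $a\in\mathbb{Q}_p$, $r\in\{p^m : m\in\mathbb{Z}\}$, and let $(X,\ast)$ be either the group $(V_r(a),\oplus)$ or the group $(S_r(a),\odot)$. Let $\mathcal{B}$ be the algebra of subsets of $X$ generated by the clopen subsets of $X$. If $\bar\mu$ is a measure on $\mathcal{B}$, with values in $[0,\infty)$, such that $\bar\mu(V_\rho(s))=\rho$ for every ball $V_\rho(s)\subset X$ with $s\in X$ and $\rho\in\{p^m : m\in\mathbb{Z}\}$, then $\bar\mu$ is a Haar measure on the group $(X,\ast)$, i.e. $\bar\mu$ is nonzero and $\bar\mu(x\ast A)=\bar\mu(A)$ for all $x\in X$ and $A\in\mathcal{B}$, where $x\ast A=\{x\ast y : y\in A\}$.
   Context: $\mathbb{Q}_p$ is the field of $p$-adic numbers with the $p$-adic norm $|\cdot|_p$ normalized by $|p|_p=p^{-1}$. $V_r(a)=\{x\in\mathbb{Q}_p : |x-a|_p\le r\}$ and $S_r(a)=\{x\in\mathbb{Q}_p : |x-a|_p=r\}$. The group operations are $x\oplus y=x+y-a$ on $V_r(a)$ and $x\odot y=r(x-a)(y-a)+a$ on $S_r(a)$, where the rational number $r$ is regarded as an element of $\mathbb{Q}_p$; with the subspace topology both are compact topological abelian groups. A Haar measure means a nonzero translation-invariant measure. *)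

(* Defs.v *)
From HB Require Import structures.
From mathcomp Require Import all_boot all_order all_algebra.
From mathcomp Require Import all_classical all_reals all_analysis.
From mathcomp Require Import ring.

Set Implicit Arguments.
Unset Strict Implicit.
Unset Printing Implicit Defensive.

Import Order.TTheory GRing.Theory Num.Theory.

Local Open Scope classical_set_scope.
Local Open Scope ring_scope.

(* Z_p as the inverse limit of the rings Z/p^n: an element is a coherent      *)
(* sequence whose n-th term is the residue modulo p^n, taken in [0, p^n).     *)
Record padic_int (p : nat) (p_pr : prime p) := PadicInt {
  residue :> nat -> nat;
  residue_lt : forall n, (residue n < p ^ n)%N;
  residue_coherent : forall n, (residue n.+1 %% p ^ n)%N = residue n
}.

HB.instance Definition _ (p : nat) (p_pr : prime p) :=
  gen_eqMixin (padic_int p_pr).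
HB.instance Definition _ (p : nat) (p_pr : prime p) :=
  gen_choiceMixin (padic_int p_pr).

Section PadicIntRing.
Variables (p : nat) (p_pr : prime p).
Local Notation Zp := (padic_int p_pr).
Implicit Types x y z : Zp.

Let pX_gt0 n : (0 < p ^ n)%N. Proof. by rewrite expn_gt0 prime_gt0. Qed.

Lemma padic_int_eqP x y : residue x =1 residue y -> x = y.
Proof.
case: x y => [x x1 x2] [y y1 y2] /= /funext xy.
by subst y; congr PadicInt; exact: Prop_irrelevance.
Qed.

Lemma modn_pX n k : (k %% p ^ n.+1 %% p ^ n = k %% p ^ n)%N.
Proof. by rewrite modn_dvdm // dvdn_exp2l. Qed.

Definition residues_of (f : nat -> nat)
  (fP : forall n, f n.+1 = f n %[mod p ^ n]) : Zp.
Proof.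
exists (fun n => f n %% p ^ n)%N => n; first by rewrite ltn_mod.
by rewrite modn_pX.
Defined.

Lemma residueS x n : x n.+1 = x n %[mod p ^ n].
Proof. by rewrite residue_coherent modn_small // residue_lt. Qed.

Fact zp_add_subproof x y n : (x n.+1 + y n.+1 = x n + y n %[mod p ^ n])%N.
Proof. by rewrite -modnDm !residueS modnDm. Qed.
Fact zp_mul_subproof x y n : (x n.+1 * y n.+1 = x n * y n %[mod p ^ n])%N.
Proof. by rewrite -modnMm !residueS modnMm. Qed.
Fact zp_opp_subproof x n :
  (p ^ n.+1 - x n.+1 = p ^ n - x n %[mod p ^ n])%N.
Proof.
have xl k : (x k <= p ^ k)%N by exact/ltnW/residue_lt.
apply/eqP; rewrite -(eqn_modDr (x n.+1)) subnK //.
rewrite -modnDmr residueS modnDmr subnK //.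
by rewrite modnn expnS modnMl.
Qed.

Definition zp_add x y : Zp := residues_of (zp_add_subproof x y).
Definition zp_mul x y : Zp := residues_of (zp_mul_subproof x y).
Definition zp_opp x : Zp := residues_of (zp_opp_subproof x).
Definition zp_nat (k : nat) : Zp := residues_of (fun n => erefl (k %% p ^ n)%N).

Let residue_mod x n : (x n %% p ^ n)%N = x n.
Proof. by rewrite modn_small // residue_lt. Qed.

Fact zp_addA : associative zp_add.
Proof. by move=> x y z; apply: padic_int_eqP => n /=; rewrite modnDmr modnDml addnA. Qed.
Fact zp_addC : commutative zp_add.
Proof. by move=> x y; apply: padic_int_eqP => n /=; rewrite addnC. Qed.
Fact zp_add0 : left_id (zp_nat 0) zp_add.
Proof. by move=> x; apply: padic_int_eqP => n /=; rewrite modnDml add0n residue_mod. Qed.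
Fact zp_addN : left_inverse (zp_nat 0) zp_opp zp_add.
Proof.
move=> x; apply: padic_int_eqP => n /=.
by rewrite modnDml subnK ?modnn ?mod0n // ltnW ?residue_lt.
Qed.
HB.instance Definition _ :=
  GRing.isZmodule.Build Zp zp_addA zp_addC zp_add0 zp_addN.

Fact zp_mulA : associative zp_mul.
Proof. by move=> x y z; apply: padic_int_eqP => n /=; rewrite modnMmr modnMml mulnA. Qed.
Fact zp_mulC : commutative zp_mul.
Proof. by move=> x y; apply: padic_int_eqP => n /=; rewrite mulnC. Qed.
Fact zp_mul1 : left_id (zp_nat 1) zp_mul.
Proof. by move=> x; apply: padic_int_eqP => n /=; rewrite modnMml mul1n residue_mod. Qed.
Fact zp_mulDl : left_distributive zp_mul (@GRing.add Zp).
Proof.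
move=> x y z; apply: padic_int_eqP => n /=.
by rewrite modnMml modnDm mulnDl.
Qed.
Fact zp_1neq0 : zp_nat 1 != 0.
Proof.
apply/eqP => /(congr1 (fun x : Zp => x 1%N)) /=.
by rewrite mod0n modn_small // expn1 prime_gt1.
Qed.
HB.instance Definition _ := GRing.Zmodule_isComNzRing.Build Zp
  zp_mulA zp_mulC zp_mul1 zp_mulDl zp_1neq0.

Lemma residue0 n : (0 : Zp) n = 0%N. Proof. exact: mod0n. Qed.
Lemma residueD x y n : (x + y) n = ((x n + y n) %% p ^ n)%N. Proof. by []. Qed.
Lemma residueM x y n : (x * y) n = ((x n * y n) %% p ^ n)%N. Proof. by []. Qed.

Lemma residue_le x m n : (m <= n)%N -> (x n %% p ^ m)%N = x m.
Proof.
move=> /subnK <-; elim: (n - m)%N => [|k IH]; first exact: residue_mod.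
rewrite addSn -IH -[x (k + m)%N]residue_coherent modn_dvdm //.
by rewrite dvdn_exp2l // leq_addl.
Qed.

Lemma residue_dvd x m n : (m <= n)%N -> (p ^ m %| x n)%N = (x m == 0%N).
Proof. by move=> mn; rewrite /dvdn residue_le. Qed.

Lemma padic_int_neq0 x : x != 0 -> exists n, x n != 0%N.
Proof.
move=> x0; apply: contrapT => /forallNP h; case/eqP: x0.
by apply: padic_int_eqP => n; rewrite residue0; apply/eqP/negPn/negP/h.
Qed.

Lemma residue_00 x : x 0%N = 0%N.
Proof. by have := residue_lt x 0; rewrite expn0 ltnS leqn0 => /eqP. Qed.

(* The largest n such that p^n divides x, and 0 by convention if x = 0.       *)
Definition zp_val x : nat :=
  if pselect (exists n, x n != 0%N) is left e then (ex_minn e).-1 else 0%N.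

Lemma zp_valP x n : x != 0 -> (x n == 0%N) = (n <= zp_val x)%N.
Proof.
move=> /padic_int_neq0 x0; rewrite /zp_val; case: pselect => // e.
case: ex_minnP => -[|k]; first by rewrite residue_00.
move=> xk kmin /=; apply/idP/idP => [xn|nk].
  rewrite leqNgt; apply: contra xk => kn.
  by rewrite -(residue_le x kn) (eqP xn) mod0n.
by apply/negPn/negP => /kmin; rewrite ltnNge nk.
Qed.

Lemma zp_val_logn x n : x != 0 -> (zp_val x < n)%N ->
  (0 < x n)%N /\ logn p (x n) = zp_val x.
Proof.
move=> x0 vn; have xn : (0 < x n)%N by rewrite lt0n zp_valP // -ltnNge.
split => //; apply/eqP; rewrite eqn_leq; apply/andP; split.
  rewrite leqNgt -pfactor_dvdn // residue_dvd //.
  by rewrite zp_valP // ltnn.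
by rewrite -pfactor_dvdn // residue_dvd 1?ltnW // zp_valP.
Qed.

Lemma residueM_eq0 x y n : x != 0 -> y != 0 ->
  ((x * y) n == 0%N) = (n <= zp_val x + zp_val y)%N.
Proof.
move=> x0 y0; pose N := (maxn n (zp_val x + zp_val y).+1)%N.
have vx : (zp_val x < N)%N.
  by rewrite leq_max; apply/orP; right; rewrite ltnS leq_addr.
have vy : (zp_val y < N)%N.
  by rewrite leq_max; apply/orP; right; rewrite ltnS leq_addl.
have [x1 x2] := zp_val_logn x0 vx; have [y1 y2] := zp_val_logn y0 vy.
have nN : (n <= N)%N by rewrite leq_maxl.
rewrite -(residue_dvd _ nN) residueM /dvdn modn_dvdm ?dvdn_exp2l //.
by rewrite -/(dvdn _ _) pfactor_dvdn ?muln_gt0 ?x1 // lognM // x2 y2.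
Qed.

Fact zp_mulf_eq0 x y : x * y = 0 -> (x == 0) || (y == 0).
Proof.
move=> xy; apply/norP => -[x0 y0].
have := residueM_eq0 (zp_val x + zp_val y).+1 x0 y0.
by rewrite xy residue0 eqxx ltnn.
Qed.

Definition zp_unit : pred Zp := fun x => `[< exists y, y * x = 1 >].
Definition zp_inv x : Zp :=
  if pselect (exists y, y * x = 1) is left e then sval (cid e) else x.
Fact zp_mulVx : {in zp_unit, left_inverse 1 zp_inv *%R}.
Proof.
move=> x /asboolP e; rewrite /zp_inv; case: pselect => // e'.
by case: cid.
Qed.
Fact zp_unitPl x y : y * x = 1 -> zp_unit x.
Proof. by move=> h; apply/asboolP; exists y. Qed.
Fact zp_invr_out : {in [predC zp_unit], zp_inv =1 id}.
Proof.
by move=> x /negP nx; rewrite /zp_inv; case: pselect => // e; case: nx; exact/asboolP.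
Qed.
HB.instance Definition _ :=
  GRing.ComNzRing_hasMulInverse.Build Zp zp_mulVx zp_unitPl zp_invr_out.
HB.instance Definition _ := GRing.ComUnitRing_isIntegral.Build Zp zp_mulf_eq0.

Lemma zp_valM x y : x != 0 -> y != 0 -> zp_val (x * y) = (zp_val x + zp_val y)%N.
Proof.
move=> x0 y0; have xy0 : x * y != 0 by rewrite mulf_neq0.
have h n : (n <= zp_val (x * y)%R)%N = (n <= zp_val x + zp_val y)%N.
  by rewrite -zp_valP // residueM_eq0.
by apply/eqP; rewrite eqn_leq -h leqnn h leqnn.
Qed.

Definition zp_norm x : rat := if x == 0 then 0 else p%:R ^- zp_val x.

Let p_gt0 : 0 < p%:R :> rat. Proof. by rewrite ltr0n prime_gt0. Qed.
Let p_gt1 : 1 < p%:R :> rat. Proof. by rewrite ltr1n prime_gt1. Qed.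

Lemma zp_norm_ge0 x : 0 <= zp_norm x.
Proof. by rewrite /zp_norm; case: ifP => // _; rewrite invr_ge0 exprn_ge0 // ltW. Qed.

Lemma zp_norm_eq0 x : (zp_norm x == 0) = (x == 0).
Proof.
rewrite /zp_norm; case: ifP => [|x0]; first by rewrite eqxx.
by rewrite invr_eq0 expf_eq0 (gt_eqF p_gt0) andbF.
Qed.

Lemma zp_normM x y : zp_norm (x * y) = zp_norm x * zp_norm y.
Proof.
rewrite /zp_norm mulf_eq0; case: eqVneq => [|x0] /=; first by rewrite mul0r.
case: eqVneq => [|y0] /=; first by rewrite mulr0.
by rewrite zp_valM // exprD invfM.
Qed.

Lemma zp_norm_le x n : (zp_norm x <= p%:R ^- n) = (x n == 0%N).
Proof.
rewrite /zp_norm; case: eqVneq => [->|x0].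
  by rewrite residue0 eqxx invr_ge0 exprn_ge0 // ltW.
by rewrite zp_valP // lef_pV2 ?posrE ?exprn_gt0 // ler_eXn2l.
Qed.

Lemma zp_normD x y : zp_norm (x + y) <= Num.max (zp_norm x) (zp_norm y).
Proof.
wlog xy : x y / zp_norm x <= zp_norm y.
  move=> H; case: (leP (zp_norm x) (zp_norm y)) => h.
    by move: (H _ _ h); rewrite (max_idPr h).
  by rewrite addrC; move: (H _ _ (ltW h)); rewrite (max_idPr (ltW h)).
rewrite (max_idPr xy).
have [y0|y0] := eqVneq y 0.
  move: xy; rewrite y0 {2}/zp_norm eqxx.
  rewrite le_eqVlt ltNge zp_norm_ge0 orbF zp_norm_eq0 => /eqP ->.
  by rewrite addr0.
have e : zp_norm y = p%:R ^- zp_val y by rewrite /zp_norm (negPf y0).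
rewrite e zp_norm_le residueD.
move: xy; rewrite e zp_norm_le => /eqP ->.
have := lexx (zp_norm y); rewrite {2}e zp_norm_le => /eqP ->.
by rewrite mod0n.
Qed.

Lemma residue_nat k n : (k%:R : Zp) n = (k %% p ^ n)%N.
Proof.
elim: k => [|k IH]; first by rewrite residue0 mod0n.
by rewrite -addn1 natrD residueD IH modnDm.
Qed.

Lemma zp_norm1 : zp_norm 1 = 1.
Proof.
have n1 : zp_norm 1 != 0 by rewrite zp_norm_eq0 oner_eq0.
by apply: (mulfI n1); rewrite -zp_normM !mulr1.
Qed.

Lemma zp_normp : zp_norm p%:R = p%:R^-1.
Proof.
have p0 : (p%:R : Zp) != 0.
  apply/eqP => /(congr1 (fun x : Zp => x 2%N)); rewrite residue_nat residue0.
  rewrite modn_small; last by rewrite -{1}[p]expn1 ltn_exp2l // prime_gt1.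
  by apply/eqP; rewrite -lt0n prime_gt0.
have vE n : (n <= zp_val (p%:R : Zp))%N = (n <= 1)%N.
  rewrite -zp_valP // residue_nat -/(dvdn _ _).
  by rewrite pfactor_dvdn ?prime_gt0 // -[X in logn _ X]expn1 pfactorK.
rewrite /zp_norm (negPf p0).
suff -> : zp_val (p%:R : Zp) = 1%N by rewrite expr1.
by apply/eqP; rewrite eqn_leq -vE leqnn vE.
Qed.

End PadicIntRing.

Definition padic (p : nat) (p_pr : prime p) : Type := {fraction padic_int p_pr}.

HB.instance Definition _ (p : nat) (p_pr : prime p) := Choice.on (padic p_pr).

(* The field structure is that of {fraction padic_int p_pr}; the operations   *)
(* are locked only to keep unification from unfolding the quotient.           *)
HB.lock Definition padic_add (p : nat) (p_pr : prime p) (x y : padic p_pr) :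
  padic p_pr := (x : {fraction padic_int p_pr}) + y.
HB.lock Definition padic_opp (p : nat) (p_pr : prime p) (x : padic p_pr) :
  padic p_pr := - (x : {fraction padic_int p_pr}).
HB.lock Definition padic_mul (p : nat) (p_pr : prime p) (x y : padic p_pr) :
  padic p_pr := (x : {fraction padic_int p_pr}) * y.
HB.lock Definition padic_inv (p : nat) (p_pr : prime p) (x : padic p_pr) :
  padic p_pr := (x : {fraction padic_int p_pr})^-1.
HB.lock Definition padic_of_int (p : nat) (p_pr : prime p)
  (u : padic_int p_pr) : padic p_pr := FracField.tofrac u.

Section PadicField.
Variables (p : nat) (p_pr : prime p).
Local Notation Zp := (padic_int p_pr).
Local Notation Qp := (padic p_pr).
Local Notation F := {fraction padic_int p_pr}.
Local Notation add := (@padic_add p p_pr).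
Local Notation opp := (@padic_opp p p_pr).
Local Notation mul := (@padic_mul p p_pr).
Local Notation inv := (@padic_inv p p_pr).
Local Notation of_int := (@padic_of_int p p_pr).

Fact padic_addA : associative add.
Proof. by move=> x y z; rewrite padic_add.unlock; exact: (@addrA F). Qed.
Fact padic_addC : commutative add.
Proof. by move=> x y; rewrite padic_add.unlock; exact: (@addrC F). Qed.
Fact padic_add0 : left_id (of_int 0) add.
Proof.
by move=> x; rewrite padic_add.unlock padic_of_int.unlock; exact: (@add0r F).
Qed.
Fact padic_addN : left_inverse (of_int 0) opp add.
Proof.
move=> x; rewrite padic_add.unlock padic_opp.unlock padic_of_int.unlock.
exact: (@addNr F).
Qed.
HB.instance Definition _ :=
  GRing.isZmodule.Build Qp padic_addA padic_addC padic_add0 padic_addN.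

Fact padic_mulA : associative mul.
Proof. by move=> x y z; rewrite padic_mul.unlock; exact: (@mulrA F). Qed.
Fact padic_mulC : commutative mul.
Proof. by move=> x y; rewrite padic_mul.unlock; exact: (@mulrC F). Qed.
Fact padic_mul1 : left_id (of_int 1) mul.
Proof.
by move=> x; rewrite padic_mul.unlock padic_of_int.unlock; exact: (@mul1r F).
Qed.
Fact padic_mulDl : left_distributive mul (@GRing.add Qp).
Proof.
move=> x y z; rewrite /GRing.add /= padic_mul.unlock padic_add.unlock.
exact: (@mulrDl F).
Qed.
Fact padic_1neq0 : of_int 1 != 0 :> Qp.
Proof. by rewrite /GRing.zero /= padic_of_int.unlock tofrac_eq oner_eq0. Qed.
HB.instance Definition _ := GRing.Zmodule_isComNzRing.Build Qp
  padic_mulA padic_mulC padic_mul1 padic_mulDl padic_1neq0.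

Fact padic_mulV (x : Qp) : x != 0 -> inv x * x = 1.
Proof.
rewrite /GRing.zero /GRing.mul /GRing.one /=.
rewrite padic_mul.unlock padic_inv.unlock padic_of_int.unlock => x0.
exact: (@mulVf F).
Qed.
Fact padic_inv0 : inv 0 = 0 :> Qp.
Proof.
rewrite /GRing.zero /= padic_inv.unlock padic_of_int.unlock.
exact: (@invr0 F).
Qed.
HB.instance Definition _ := GRing.ComNzRing_isField.Build Qp padic_mulV padic_inv0.

Fact padic_of_int_zmod_morphism : zmod_morphism of_int.
Proof.
move=> u v; rewrite /GRing.add /GRing.opp /=.
rewrite padic_add.unlock padic_opp.unlock padic_of_int.unlock.
exact: tofracB.
Qed.
Fact padic_of_int_monoid_morphism : monoid_morphism of_int.
Proof.
split=> [//|u v]; rewrite /GRing.mul /= padic_mul.unlock padic_of_int.unlock.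
exact: tofracM.
Qed.
HB.instance Definition _ :=
  GRing.isZmodMorphism.Build Zp Qp of_int padic_of_int_zmod_morphism.
HB.instance Definition _ :=
  GRing.isMonoidMorphism.Build Zp Qp of_int padic_of_int_monoid_morphism.

Lemma padic_of_int_inj : injective of_int.
Proof.
by move=> u v; rewrite padic_of_int.unlock => /eqP; rewrite tofrac_eq => /eqP.
Qed.

Lemma padic_of_int_eq0 (u : Zp) : (of_int u == 0) = (u == 0).
Proof. by rewrite -(rmorph0 of_int) (inj_eq padic_of_int_inj). Qed.

End PadicField.

(* |u / v|_p = |u|_p / |v|_p for u, v in Z_p. The norm is rational-valued,    *)
(* its values being 0 and the powers of p.                                    *)
Definition padic_norm (p : nat) (p_pr : prime p) (x : padic p_pr) : rat :=
  zp_norm (repr x : {ratio padic_int p_pr}).1 /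
  zp_norm (repr x : {ratio padic_int p_pr}).2.

Lemma ratio_numden (R : idomainType) (q : {ratio R}) :
  (\pi_({fraction R})%qT q * FracField.tofrac q.2 = FracField.tofrac q.1
    :> {fraction R}).
Proof.
unlock FracField.tofrac; rewrite -[LHS]FracField.pi_mul; apply/eqmodP => /=.
rewrite FracField.equivfE /FracField.mulf.
by rewrite !numden_Ratio ?oner_eq0 ?mulr1 ?denom_ratioP // mulrC.
Qed.

Section PadicNorm.
Variables (p : nat) (p_pr : prime p).
Local Notation Qp := (padic p_pr).
Local Notation "x %:F" := (@padic_of_int p p_pr x).
Implicit Types x y z : Qp.

Lemma padic_numden x : exists u v : padic_int p_pr,
  [/\ v != 0, x = u%:F / v%:F & padic_norm x = zp_norm u / zp_norm v].
Proof.
pose q : {ratio padic_int p_pr} := repr x.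
exists q.1, q.2; have q0 : q.2 != 0 by exact: denom_ratioP.
split=> //; apply: (canRL (mulfK _)); first by rewrite padic_of_int_eq0.
have -> : x = \pi_({fraction padic_int p_pr})%qT q by rewrite /q reprK.
rewrite /GRing.mul /= padic_mul.unlock padic_of_int.unlock.
exact: ratio_numden.
Qed.

Lemma padic_norm_div (u v : padic_int p_pr) : v != 0 ->
  padic_norm (u%:F / v%:F) = zp_norm u / zp_norm v.
Proof.
move=> v0; have [u' [v' [v'0 e ->]]] := padic_numden (u%:F / v%:F).
have nz w : w != 0 -> zp_norm w != 0 by rewrite zp_norm_eq0.
apply/eqP; rewrite eqr_div ?nz // -!zp_normM; apply/eqP; congr zp_norm.
apply/eqP; rewrite -(inj_eq (@padic_of_int_inj _ _)) !rmorphM -eqr_div ?padic_of_int_eq0 //.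
by rewrite eq_sym; apply/eqP.
Qed.

Lemma padic_norm_ge0 x : 0 <= padic_norm x.
Proof. by apply: divr_ge0; exact: zp_norm_ge0. Qed.

Lemma padic_norm0 : padic_norm (0 : Qp) = 0.
Proof.
have -> : (0 : Qp) = 0%:F / 1%:F by rewrite rmorph0 mul0r.
by rewrite padic_norm_div ?oner_eq0 // /zp_norm eqxx mul0r.
Qed.

Lemma padic_norm_eq0 x : (padic_norm x == 0) = (x == 0).
Proof.
have [u [v [v0 -> _]]] := padic_numden x.
rewrite padic_norm_div // !mulf_eq0 !invr_eq0 !zp_norm_eq0.
by rewrite !padic_of_int_eq0.
Qed.

Lemma padic_normM x y : padic_norm (x * y) = padic_norm x * padic_norm y.
Proof.
have [u [v [v0 -> _]]] := padic_numden x.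
have [w [z [z0 -> _]]] := padic_numden y.
rewrite mulf_div -!rmorphM !padic_norm_div ?mulf_neq0 //.
by rewrite !zp_normM mulf_div.
Qed.

Lemma padic_norm1 : padic_norm (1 : Qp) = 1.
Proof.
have n1 : padic_norm (1 : Qp) != 0 by rewrite padic_norm_eq0 oner_eq0.
by apply: (mulfI n1); rewrite -padic_normM !mulr1.
Qed.

Lemma padic_normV x : padic_norm x^-1 = (padic_norm x)^-1.
Proof.
have [->|x0] := eqVneq x 0; first by rewrite invr0 padic_norm0 invr0.
have n0 : padic_norm x != 0 by rewrite padic_norm_eq0.
by apply: (mulfI n0); rewrite -padic_normM !mulfV // padic_norm1.
Qed.

Lemma padic_normN x : padic_norm (- x) = padic_norm x.
Proof.
rewrite -mulN1r padic_normM.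
suff -> : padic_norm (-1 : Qp) = 1 by rewrite mul1r.
apply/eqP; rewrite -(@eqrXn2 _ 2) ?padic_norm_ge0 // expr1n expr2.
by rewrite -padic_normM mulrNN mulr1 padic_norm1.
Qed.

Lemma padic_norm_distC x y : padic_norm (x - y) = padic_norm (y - x).
Proof. by rewrite -padic_normN opprB. Qed.

Lemma padic_normD x y :
  padic_norm (x + y) <= Num.max (padic_norm x) (padic_norm y).
Proof.
have [u [v [v0 -> _]]] := padic_numden x.
have [w [z [z0 -> _]]] := padic_numden y.
have nz t : t != 0 -> zp_norm t != 0 by rewrite zp_norm_eq0.
rewrite addf_div ?padic_of_int_eq0 // -!rmorphM -rmorphD.
rewrite !padic_norm_div ?mulf_neq0 //.
have vz0 : 0 < zp_norm (v * z).
  by rewrite lt0r nz ?mulf_neq0 ?zp_norm_ge0.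
rewrite ler_pdivrMr // (maxr_pMl _ _ (ltW vz0)).
have -> : zp_norm u / zp_norm v * zp_norm (v * z) = zp_norm (u * z).
  by rewrite !zp_normM mulrA divfK ?nz.
have -> : zp_norm w / zp_norm z * zp_norm (v * z) = zp_norm (w * v).
  by rewrite !zp_normM (mulrC (zp_norm v)) mulrA divfK ?nz.
exact: zp_normD.
Qed.

Lemma padic_normB x y :
  padic_norm (x - y) <= Num.max (padic_norm x) (padic_norm y).
Proof. by rewrite -(padic_normN y) padic_normD. Qed.

Lemma padic_normp : padic_norm (p%:R : Qp) = p%:R^-1.
Proof.
have -> : (p%:R : Qp) = (p%:R)%:F / 1%:F.
  by rewrite rmorph1 divr1 rmorph_nat.
by rewrite padic_norm_div ?oner_eq0 // zp_norm1 divr1 zp_normp.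
Qed.

Lemma padic_normXp (m : int) : padic_norm ((p%:R : Qp) ^ m) = (p%:R ^ m)^-1.
Proof.
have nX n : padic_norm ((p%:R : Qp) ^+ n) = (p%:R ^+ n)^-1.
  elim: n => [|n IH]; first by rewrite !expr0 padic_norm1 invr1.
  by rewrite !exprS padic_normM IH padic_normp invfM.
by case: m => n; rewrite /exprz ?padic_normV nX.
Qed.

Let dist x y : rat := padic_norm (x - y).

Fact padic_distxx x : dist x x = 0.
Proof. by rewrite /dist subrr padic_norm0. Qed.
Fact padic_dist_eq0 x y : dist x y = 0 -> x = y.
Proof. by move/eqP; rewrite padic_norm_eq0 subr_eq0 => /eqP. Qed.
Fact padic_dist_sym x y : dist x y = dist y x.
Proof. exact: padic_norm_distC. Qed.
Fact padic_dist_triangle y x z : dist x z <= dist x y + dist y z.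
Proof.
rewrite /dist -(subrKA y); apply: (le_trans (padic_normD _ _)).
by rewrite ge_max lerDl lerDr !padic_norm_ge0.
Qed.

HB.instance Definition _ := Choice.on Qp.
HB.instance Definition _ := isMetric.Build rat Qp
  padic_distxx padic_dist_eq0 padic_dist_sym padic_dist_triangle.

Lemma padic_ballE x (e : rat) y : ball x e y = (padic_norm (x - y) < e) :> Prop.
Proof. by []. Qed.

End PadicNorm.

(* A map into a subspace of Q_p that does not increase the sup distance.      *)
Lemma padic_nonexpansive_continuous (p : nat) (p_pr : prime p)
    (A : set (padic p_pr)) (f : A * A -> A) :
  (forall u v : A * A, padic_norm (val (f u) - val (f v)) <=
    Num.max (padic_norm (val u.1 - val v.1)) (padic_norm (val u.2 - val v.2))) ->
  continuous f.
Proof.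
move=> fP; apply: (@continuous_comp_initial _ _ _ set_val) => u.
apply/cvg_ballP => e e0.
have n1 : \forall v \near u, ball (set_val u.1) e (set_val v.1).
  have h : {for u, continuous (fun v : A * A => set_val v.1)}.
    by apply: continuous_comp; [exact: cvg_fst|exact: initial_continuous].
  exact: (cvg_ball h e0).
have n2 : \forall v \near u, ball (set_val u.2) e (set_val v.2).
  have h : {for u, continuous (fun v : A * A => set_val v.2)}.
    by apply: continuous_comp; [exact: cvg_snd|exact: initial_continuous].
  exact: (cvg_ball h e0).
near=> v; rewrite padic_ballE; apply: (le_lt_trans (fP u v)).
rewrite gt_max; apply/andP; split; first by near: v.
by near: v.
Unshelve. all: by end_near. Qed.

Fact sphere_sub_eq (F : fieldType) (c a X Y Z T : F) :
  c != 0 -> T != 0 -> Y != 0 ->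
  c * X * ((c ^+ 2)^-1 / Y) + a - (c * Z * ((c ^+ 2)^-1 / T) + a) =
  c^-1 * Y^-1 * T^-1 * (X * (T - Y) + Y * (X - Z)).
Proof. by move=> c0 T0 Y0; field; rewrite c0 T0 Y0. Qed.

Section PadicGroups.
Variables (p : nat) (p_pr : prime p).
Local Notation Qp := (padic p_pr).

Definition padic_ball (r : rat) (a : Qp) : set Qp :=
  [set x | padic_norm (x - a) <= r].

Definition padic_sphere (r : rat) (a : Qp) : set Qp :=
  [set x | padic_norm (x - a) = r].

Variables (a : Qp) (m : int).

Let r : rat := p%:R ^ m.
Let rp : Qp := p%:R ^ m.

Let r_gt0 : 0 < r. Proof. by rewrite exprz_gt0 // ltr0n prime_gt0. Qed.
Let norm_rp : padic_norm rp = r^-1. Proof. exact: padic_normXp. Qed.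
Let rp_neq0 : rp != 0.
Proof. by rewrite -padic_norm_eq0 norm_rp invr_eq0 gt_eqF. Qed.

(* V_r(a) and S_r(a) for r = p^m, with the subspace topology. Both groups are *)
(* abelian and are given the additive structure of topologicalZmodType, so    *)
(* that + below stands for x (+) y = x + y - a and for x (.) y =              *)
(* r (x - a) (y - a) + a respectively.                                        *)
Definition ball_group : Type := set_type (padic_ball (p%:R ^ m) a).
Definition sphere_group : Type := set_type (padic_sphere (p%:R ^ m) a).

HB.instance Definition _ := SubChoice.on ball_group.
HB.instance Definition _ := Topological.on ball_group.
HB.instance Definition _ := SubChoice.on sphere_group.
HB.instance Definition _ := Topological.on sphere_group.

Definition ball_point (x : Qp) (xP : padic_ball (p%:R ^ m) a x) : ball_group :=
  exist _ x (mem_set xP).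
Definition sphere_point (x : Qp) (xP : padic_sphere (p%:R ^ m) a x) :
  sphere_group := exist _ x (mem_set xP).

Lemma ball_groupP (x : ball_group) : padic_norm (val x - a) <= r.
Proof. exact: (set_valP x). Qed.
Lemma sphere_groupP (x : sphere_group) : padic_norm (val x - a) = r.
Proof. exact: (set_valP x). Qed.

Fact ball_add_subproof (x y : ball_group) :
  padic_ball (p%:R ^ m) a (val x + val y - a).
Proof.
rewrite /padic_ball /= -[_ - a - a]addrA addrACA.
by apply: (le_trans (padic_normD _ _)); rewrite ge_max !ball_groupP.
Qed.
Fact ball_opp_subproof (x : ball_group) : padic_ball (p%:R ^ m) a (a - (val x - a)).
Proof. by rewrite /padic_ball /= addrC addrA addNr sub0r padic_normN ball_groupP. Qed.
Fact ball_zero_subproof : padic_ball (p%:R ^ m) a a.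
Proof. by rewrite /padic_ball /= subrr padic_norm0 ltW. Qed.

Definition ball_add (x y : ball_group) : ball_group :=
  ball_point (ball_add_subproof x y).
Definition ball_opp (x : ball_group) : ball_group :=
  ball_point (ball_opp_subproof x).
Definition ball_zero : ball_group := ball_point ball_zero_subproof.

Fact ball_addA : associative ball_add.
Proof. by move=> x y z; apply: val_inj => /=; ring. Qed.
Fact ball_addC : commutative ball_add.
Proof. by move=> x y; apply: val_inj => /=; ring. Qed.
Fact ball_add0 : left_id ball_zero ball_add.
Proof. by move=> x; apply: val_inj => /=; ring. Qed.
Fact ball_addN : left_inverse ball_zero ball_opp ball_add.
Proof. by move=> x; apply: val_inj => /=; ring. Qed.
HB.instance Definition _ :=
  GRing.isZmodule.Build ball_group ball_addA ball_addC ball_add0 ball_addN.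

Fact ball_sub_continuous : continuous (fun x : ball_group * ball_group => x.1 - x.2).
Proof.
apply: padic_nonexpansive_continuous => u v /=.
rewrite [X in padic_norm X <= _](_ : _ =
  (val u.1 - val v.1) - (val u.2 - val v.2)); last by rewrite /=; ring.
exact: padic_normB.
Qed.
HB.instance Definition _ := PreTopologicalNmodule_isTopologicalZmodule.Build
  ball_group ball_sub_continuous.

Let sphere_neq0 (x : sphere_group) : val x - a != 0.
Proof. by rewrite -padic_norm_eq0 sphere_groupP gt_eqF. Qed.

Fact sphere_add_subproof (x y : sphere_group) :
  padic_sphere (p%:R ^ m) a (p%:R ^ m * (val x - a) * (val y - a) + a).
Proof.
rewrite /padic_sphere /= addrK !padic_normM padic_normXp !sphere_groupP -/r.
by rewrite mulVf ?mul1r // gt_eqF.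
Qed.
Fact sphere_opp_subproof (x : sphere_group) :
  padic_sphere (p%:R ^ m) a (((p%:R ^ m) ^+ 2)^-1 / (val x - a) + a).
Proof.
rewrite /padic_sphere /= addrK padic_normM !padic_normV sphere_groupP.
by rewrite expr2 padic_normM padic_normXp -/r invfM invrK mulfK // gt_eqF.
Qed.
Fact sphere_zero_subproof : padic_sphere (p%:R ^ m) a ((p%:R ^ m)^-1 + a).
Proof. by rewrite /padic_sphere /= addrK padic_normV padic_normXp invrK. Qed.

Definition sphere_add (x y : sphere_group) : sphere_group :=
  sphere_point (sphere_add_subproof x y).
Definition sphere_opp (x : sphere_group) : sphere_group :=
  sphere_point (sphere_opp_subproof x).
Definition sphere_zero : sphere_group := sphere_point sphere_zero_subproof.

Fact sphere_addA : associative sphere_add.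
Proof. by move=> x y z; apply: val_inj => /=; ring. Qed.
Fact sphere_addC : commutative sphere_add.
Proof. by move=> x y; apply: val_inj => /=; ring. Qed.
Fact sphere_add0 : left_id sphere_zero sphere_add.
Proof.
move=> x; apply: val_inj => /=; rewrite addrK mulfV // mul1r.
by rewrite subrK.
Qed.
Fact sphere_addN : left_inverse sphere_zero sphere_opp sphere_add.
Proof.
move=> x; apply: val_inj => /=; rewrite addrK -mulrA divfK ?sphere_neq0 //.
by rewrite expr2 invfM mulrA mulfV // mul1r.
Qed.
HB.instance Definition _ := GRing.isZmodule.Build sphere_group
  sphere_addA sphere_addC sphere_add0 sphere_addN.

Fact sphere_sub_continuous :
  continuous (fun x : sphere_group * sphere_group => x.1 - x.2).
Proof.
apply: padic_nonexpansive_continuous => -[x y] [z t] /=.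
have := sphere_neq0 y; have := sphere_neq0 t.
have := sphere_groupP x; have := sphere_groupP y; have := sphere_groupP t.
rewrite /= -/rp !addrK; set X := val x - a; set Y := val y - a.
set Z := val z - a; set T := val t - a => nT nY nX T0 Y0.
have -> : rp * X * (rp ^- 2 / Y) + a - (rp * Z * (rp ^- 2 / T) + a) =
    rp^-1 * Y^-1 * T^-1 * (X * (val t - val y) + Y * (val x - val z)).
  have -> : val t - val y = T - Y by rewrite /T /Y; ring.
  have -> : val x - val z = X - Z by rewrite /X /Z; ring.
  exact: sphere_sub_eq.
rewrite !(padic_normM, padic_normV) nT nY norm_rp invrK.
rewrite divff ?gt_eqF // mul1r ler_pdivrMl //.
apply: (le_trans (padic_normD _ _)); rewrite !padic_normM nX nY.
by rewrite (maxr_pMr _ _ (ltW r_gt0)) maxC (padic_norm_distC (val t)).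
Qed.
HB.instance Definition _ := PreTopologicalNmodule_isTopologicalZmodule.Build
  sphere_group sphere_sub_continuous.

End PadicGroups.

Definition set_algebra T (G : set (set T)) :=
  [/\ G set0, setU_closed G & setC_closed G].

(* An alias of a topological group G whose measurable sets are the members of *)
(* the algebra (not sigma-algebra) of sets generated by the clopen sets of G. *)
Definition clopen_algebra (T : Type) : Type := T.

Fact clopen_display : measure_display. Proof. exact: default_measure_display. Qed.

Section ClopenAlgebra.
Variable G : topologicalZmodType.

Let B : set (set G) := smallest (@set_algebra G) clopen.

Fact clopen_algebra0 : B set0.
Proof. by move=> C [[C0 _ _] _]. Qed.
Fact clopen_algebraU : setU_closed B.
Proof. by move=> X Y BX BY C hC; have [[_ CU _] _] := hC; apply: CU; [exact: BX|exact: BY]. Qed.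
Fact clopen_algebraC : setC_closed B.
Proof. by move=> X BX C hC; have [[_ _ CC] _] := hC; apply: CC; exact: BX. Qed.

HB.instance Definition _ := TopologicalZmodule.on (clopen_algebra G).
HB.instance Definition _ := isPointed.Build (clopen_algebra G) (0 : G).
HB.instance Definition _ := isAlgebraOfSets.Build clopen_display
  (clopen_algebra G) clopen_algebra0 clopen_algebraU clopen_algebraC.

End ClopenAlgebra.

Definition is_haar_measure (R : realType) (G : topologicalZmodType)
    (mu : {measure set (clopen_algebra G) -> \bar R}) : Prop :=
  (exists2 A : set (clopen_algebra G), measurable A & mu A <> 0%E) /\
  (forall (x : clopen_algebra G) (A : set (clopen_algebra G)), measurable A ->
     measurable [set x + y | y in A] /\ mu [set x + y | y in A] = mu A).

(* Main.v *)
Require Import Defs.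
From mathcomp Require Import all_boot all_order all_algebra.
From mathcomp Require Import all_classical all_reals all_analysis.
From mathcomp Require Import ring.

Set Implicit Arguments.
Unset Strict Implicit.
Unset Printing Implicit Defensive.

Import Order.TTheory GRing.Theory Num.Theory.

Local Open Scope classical_set_scope.
Local Open Scope ring_scope.

(** Both groups carry a translation-invariant ultrametric, that of Q_p (on the
    sphere because |p^m|_p |x - a|_p = 1). Hence the balls around the neutral
    element form a decreasing sequence of open subgroups H_n that is a
    neighbourhood basis there, and the balls of the same radius are exactly the
    cosets of H_n. The hypothesis on mu thus says that all cosets of H_n have
    the same measure c_n > 0, and invariance follows from this alone
    ([haar_of_cosets]), for any topological abelian group.

    - The clopen sets already form an algebra, so mu is a measure on the clopen
      sets ([measurable_clopen]).
    - If U is a union of cosets of H_n, translation permutes these cosets; as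
      each weighs c_n > 0 and mu is finite, there are finitely many, and they can
      be removed one by one ([translate_mu_saturated]). Finiteness of mu replaces
      compactness of the group.
    - An arbitrary clopen A is the increasing union of its H_n-cores, the
      largest unions of H_n-cosets inside A, because A is open. Taking cores
      commutes with translation, and mu is continuous along increasing unions.

    It remains to see that enough balls of Q_p lie in the two groups: those of
    radius at most p^m in the ball, and those of radius less than p^m, centred
    on it, in the sphere. *)

(** * Translates and unions of cosets in a topological abelian group *)

Section Translates.
Variable G : topologicalZmodType.
Implicit Types (x y : G) (A U H : set G).

(** The set x + A, as a preimage, so that membership reduces to a membership in
    A and translation commutes with set operations by computation. *)
Definition translate x A : set G := [set y | A (y - x)].

Lemma translateE x A : [set x + y | y in A] = translate x A.
Proof.
apply/seteqP; split=> [_ [y Ay <-]|y Ay] /=.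
  by rewrite /translate /= addrC addKr.
by exists (y - x) => //; rewrite addrC subrK.
Qed.

Lemma translateD x y A : translate x (translate y A) = translate (x + y) A.
Proof. by apply/seteqP; split=> z /=; rewrite /translate /= opprD addrA. Qed.

Lemma translation_continuous x : continuous (+%R x).
Proof.
move=> y; apply: (@continuous_comp _ _ _ (fun z => (x, z))
  (fun z : G * G => z.1 + z.2)).
  by apply: cvg_pair => /=; [exact: cvg_cst|exact: cvg_id].
exact: add_continuous.
Qed.

Lemma translate_clopen x A : clopen A -> clopen (translate x A).
Proof.
move=> cA; have -> : translate x A = (fun y => - x + y) @^-1` A.
  by apply/seteqP; split=> y; rewrite /translate /= addrC.
exact: (preimage_clopen cA (@translation_continuous _)).
Qed.

(** The clopen sets are closed under the operations that generate the algebra,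
    so generating adds nothing to them. *)
Lemma measurable_clopen (A : set (clopen_algebra G)) :
  measurable A <-> clopen (A : set G).
Proof.
split=> [mA|cA]; last by move=> C [_]; apply.
apply: mA; split=> //; split; [exact: clopen0 | exact: clopenU |].
by move=> X; exact: clopenC.
Qed.

(** For a subgroup H: U is a union of cosets of H. *)
Definition saturated H U := forall x y, H (y - x) -> U x -> U y.

(** For a subgroup H: the union of the cosets of H contained in A. *)
Definition saturated_core H A : set G := [set x | translate x H `<=` A].

Section OpenSubgroup.
Variable H : set G.
Hypothesis H0 : H 0.
Hypothesis HB : forall x y, H x -> H y -> H (x - y).

Lemma subgroupN x : H x -> H (- x).
Proof. by rewrite -[- x]sub0r; exact: HB. Qed.

Lemma subgroupD x y : H x -> H y -> H (x + y).
Proof. by move=> Hx Hy; rewrite -[y]opprK; apply: HB => //; exact: subgroupN. Qed.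

Lemma saturatedC U : saturated H U -> saturated H (~` U).
Proof.
move=> sU x y Hyx nUx Uy; apply/nUx/(sU y) => //.
by rewrite -opprB; exact: subgroupN.
Qed.

Lemma translate_saturated x U : saturated H U -> saturated H (translate x U).
Proof. by move=> sU y z Hzy; apply: sU; rewrite opprB addrA subrK. Qed.

Lemma coset_saturated x : saturated H (translate x H).
Proof.
apply: translate_saturated => y z Hzy Hy.
by rewrite -(subrK y z); exact: subgroupD.
Qed.

Lemma coset_sub U x : saturated H U -> U x -> translate x H `<=` U.
Proof. by move=> sU Ux y Hyx; exact: sU Ux. Qed.

Lemma saturated_core_saturated A : saturated H (saturated_core H A).
Proof.
move=> x y Hyx Ax z Hzy; apply: Ax.
by rewrite /translate /= -(subrKA y); exact: subgroupD.
Qed.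

Lemma saturated_core_sub A : saturated_core H A `<=` A.
Proof. by move=> x; apply; rewrite /translate /= subrr. Qed.

Lemma translate_saturated_core x A :
  translate x (saturated_core H A) = saturated_core H (translate x A).
Proof.
apply/seteqP; split=> y Ay z Hz.
  by apply: Ay; rewrite /translate /= opprB addrA subrK.
by have := Ay (z + x); rewrite /translate /= addrK opprB addrA in Hz *; apply.
Qed.

Hypothesis nH : nbhs 0 H.

(** Each point of a union of cosets has its whole coset, which is a
    neighbourhood of it, inside the union. *)
Lemma saturated_open U : saturated H U -> open U.
Proof.
move=> sU; rewrite openE => x Ux; rewrite /interior.
suff : nbhs x (translate x H) by apply: filterS; exact: coset_sub.
have := @translation_continuous (- x) x; rewrite /continuous_at addNr.
move=> /(_ H nH); rewrite /nbhs /=; apply: filterS => y /=.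
by rewrite /translate /= addrC.
Qed.

(** The complement of a union of cosets is a union of cosets too, hence open. *)
Lemma saturated_clopen U : saturated H U -> clopen U.
Proof.
move=> sU; split; first exact: saturated_open.
by rewrite -[U]setCK; apply/open_closedC/saturated_open/saturatedC.
Qed.

(** Induction on a bound for mu U / c, the number of cosets that make up U:
    removing one coset lowers mu U and mu (x + U) by the same amount c. *)
Lemma translate_mu_saturated (R : realType)
    (mu : {measure set (clopen_algebra G) -> \bar R}) (c : R) :
  fin_num_fun mu -> 0 < c ->
  (forall x, mu (translate x H) = c%:E) ->
  forall x U, saturated H U -> mu (translate x U) = mu U.
Proof.
move=> fmu c0 muH x U sU.
have mS V : saturated H V -> measurable (V : set (clopen_algebra G)).
  by move=> sV; apply/measurable_clopen/saturated_clopen.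
(* The bound exists by the archimedean property, as mu U is finite and c > 0. *)
have [k] : exists k, (mu U < (c *+ k)%:E)%E.
  exists (Num.bound (fine (mu U) / c)).
  rewrite -(fineK (fmu _ (mS _ sU))) lte_fin -mulr_natl -ltr_pdivrMr //.
  by apply/archi_boundP/divr_ge0; [exact: fine_ge0|exact: ltW].
elim: k U sU => [|k IH] U sU; first by rewrite mulr0n ltNge measure_ge0.
have [->|/set0P[y Uy] muU] := eqVneq U set0.
  by have -> : translate x set0 = set0 by [].
have sD : saturated H (U `\` translate y H).
  move=> z t Hzt [Uz nz]; split; first exact: sU Uz.
  exact: (saturatedC (@coset_saturated y)) nz.
have UE : U = translate y H `|` (U `\` translate y H).
  by rewrite setDUK //; exact: (coset_sub sU Uy).
have mH z : measurable (translate z H : set (clopen_algebra G)).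
  by apply: mS; apply: coset_saturated.
have cosetI z : translate z (translate y H) `&`
    translate z (U `\` translate y H) = set0.
  by apply/seteqP; split=> t // [? []].
have muE z : mu (translate z U) =
    (c%:E + mu (translate z (U `\` translate y H)))%E.
  rewrite -(muH (z + y)) -translateD -measureU //.
  - by congr (mu _); rewrite {1}UE.
  - by rewrite translateD.
  - by apply: mS; apply: translate_saturated.
have translate0 V : translate 0 V = V.
  by apply/seteqP; split=> t; rewrite /translate /= subr0.
have muU0 := muE 0; rewrite !translate0 in muU0.
rewrite muE muU0 IH //.
by move: muU; rewrite muU0 mulrS EFinD lteD2lE.
Qed.

End OpenSubgroup.

(** A measure that does not distinguish the cosets of H_n, for each n, is
    invariant on unions of such cosets; every clopen set is a monotone limit of
    them, which carries the invariance over to it. *)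
Lemma haar_of_cosets (R : realType)
    (mu : {measure set (clopen_algebra G) -> \bar R})
    (H : nat -> set G) (c : nat -> R) :
  fin_num_fun mu ->
  (forall n, H n 0) ->
  (forall n x y, H n x -> H n y -> H n (x - y)) ->
  (forall n, nbhs 0 (H n)) ->
  (forall n, H n.+1 `<=` H n) ->
  (forall U, nbhs 0 U -> exists n, H n `<=` U) ->
  (forall n, 0 < c n) ->
  (forall n x, mu (translate x (H n)) = (c n)%:E) ->
  is_haar_measure mu.
Proof.
move=> fmu H0 HB nH HS Hbase c0 muH; split.
  exists (translate 0 (H 0%N)); last by rewrite muH => -[/eqP]; rewrite gt_eqF.
  apply/measurable_clopen; apply: (saturated_clopen (H0 0%N) (HB 0%N)) => //.
  exact: (coset_saturated (H0 0%N) (HB 0%N)).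
move=> x A /measurable_clopen cA.
rewrite translateE; split; first exact/measurable_clopen/translate_clopen.
have Hle n k : (n <= k)%N -> H k `<=` H n.
  by move=> /subnK <-; elim: (k - n)%N => // i IH y /HS /IH.
(* A is open: each x in A has some coset x + H_n inside A. *)
have coreE B : clopen B -> \bigcup_n saturated_core (H n) B = B.
  move=> [oB _]; apply/seteqP; split=> [y [n _]|y By].
    exact: (saturated_core_sub (H0 n)).
  have /Hbase[n Hn] : nbhs 0 (+%R y @^-1` B).
    have := @translation_continuous y 0; rewrite /continuous_at addr0; apply.
    exact: open_nbhs_nbhs.
  by exists n => // z /Hn /=; rewrite addrC subrK.
have mcore n B : measurable (saturated_core (H n) B : set (clopen_algebra G)).
  apply/measurable_clopen; apply: (saturated_clopen (H0 n) (HB n)) => //.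
  exact: (saturated_core_saturated (H0 n) (HB n)).
have core_cvg (B : set G) : clopen B ->
    mu (saturated_core (H n) B) @[n --> \oo] --> mu B.
  move=> cB; rewrite -[X in _ --> mu X](coreE _ cB).
  apply: nondecreasing_cvg_mu => //.
    by rewrite coreE //; exact/measurable_clopen.
  move=> n k nk; apply/subsetPset => y By z Hz; apply: By.
  exact: Hle nk _ Hz.
have cvgA := core_cvg _ cA.
have := core_cvg _ (translate_clopen x cA).
have -> : (fun n => mu (saturated_core (H n) (translate x A))) =
    (fun n => mu (saturated_core (H n) A)).
  apply/funext => n; rewrite -translate_saturated_core.
  rewrite (translate_mu_saturated (H0 n) (HB n) (nH n) fmu (c0 n)) //.
  exact: (saturated_core_saturated (H0 n) (HB n)).
by move=> cvgxA; exact: cvg_unique cvgxA cvgA.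
Qed.

End Translates.

(** * Groups that embed isometrically in the p-adic numbers *)

Lemma exists_expz_lt (F : archiRealFieldType) (p : nat) (k : int) (e : F) :
  (1 < p)%N -> 0 < e ->
  exists n : nat, (p%:R : F) ^ (k - n%:Z) < e.
Proof.
move=> p1 e0.
have p0 : 0 < p%:R :> F by rewrite ltr0n ltnW.
exists (Num.bound ((p%:R : F) ^ k / e)).
rewrite expfzDr ?gt_eqF // -[p%:R ^ - _]invr_expz -exprnP.
rewrite ltr_pdivrMr ?exprn_gt0 // mulrC -ltr_pdivrMr //.
have /archi_boundP/lt_trans : 0 <= (p%:R : F) ^ k / e.
  by rewrite divr_ge0 ?exprz_ge0 // ltW.
by apply; rewrite -natrX ltr_nat ltn_expl.
Qed.

(** Translation invariance of the pulled-back distance turns the balls around 0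
    into subgroups (with the ultrametric inequality) and all other balls into
    their cosets. The bound k on the radii is there because only balls of Q_p
    small enough to stay inside the group have a prescribed measure. *)
Lemma haar_of_isometry (R : realType) (p : nat) (p_pr : prime p)
    (G : topologicalZmodType) (v : G -> padic p_pr) (k : int)
    (mu : {measure set (clopen_algebra G) -> \bar R}) :
  continuous v ->
  (forall U : set G, nbhs 0 U -> exists2 e : rat, 0 < e &
     forall x, padic_norm (v x - v 0) < e -> U x) ->
  (forall x y z, padic_norm (v (x + y) - v (x + z)) = padic_norm (v y - v z)) ->
  fin_num_fun mu ->
  (forall s (n : int), n <= k ->
     mu [set x : G | padic_ball (p%:R ^ n) (v s) (v x)] = (p%:R ^ n)%:E) ->
  is_haar_measure mu.
Proof.
move=> vcont vbase viso fmu muball.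
have pX_gt0 (F : numFieldType) (n : int) : 0 < (p%:R : F) ^ n.
  by rewrite exprz_gt0 // ltr0n prime_gt0.
pose H n : set G := [set x | padic_norm (v x - v 0) <= p%:R ^ (k - n%:Z)].
apply: (@haar_of_cosets _ _ mu H (fun n => p%:R ^ (k - n%:Z))) => //.
- by move=> n; rewrite /H /= subrr padic_norm0; exact/ltW/pX_gt0.
- move=> n x y Hx Hy; rewrite /H /=.
  have -> : padic_norm (v (x - y) - v 0) = padic_norm (v x - v y).
    by rewrite -(viso y) addr0 [y + _]addrC subrK.
  rewrite -(subrKA (v 0)); apply: le_trans (padic_normD _ _) _.
  by rewrite [padic_norm (v 0 - _)]padic_norm_distC ge_max Hx Hy.
- move=> n; have /cvg_ballP/(_ _ (pX_gt0 _ (k - n%:Z))) := vcont 0.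
  by apply: filterS => x; rewrite padic_ballE padic_norm_distC => /ltW.
- move=> n x /le_trans; apply; rewrite ler_weXz2l ?ler1n ?prime_gt0 //.
  by rewrite lerD2l lerN2 lez_nat.
- move=> U /vbase[e e0 eU]; have [n ne] := exists_expz_lt k (prime_gt1 p_pr) e0.
  by exists n => x /le_lt_trans /(_ ne); exact: eU.
- by move=> n; exact: pX_gt0.
- move=> n s; rewrite -(muball s); last by rewrite gerBl.
  congr (mu _); apply/seteqP; split=> x; rewrite /translate /H /padic_ball /=;
  by rewrite -(viso s) addr0 [s + _]addrC subrK.
Qed.

Lemma set_type_basis (p : nat) (p_pr : prime p) (A : set (padic p_pr)) (x : A)
    (U : set A) :
  nbhs x U ->
  exists2 e : rat, 0 < e & forall y : A, padic_norm (val y - val x) < e -> U y.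
Proof.
rewrite nbhsE => -[V [[W oW <-] Wx] VU].
have /nbhs_ballP[e e0 eW] : nbhs (val x) W by exact: open_nbhs_nbhs.
exists e => // y yx; apply/VU/eW; rewrite padic_ballE padic_norm_distC.
exact: yx.
Qed.

(** * Balls inside the ball and inside the sphere *)

Lemma padic_ball_subset (p : nat) (p_pr : prime p) (a s : padic p_pr) (r t : rat) :
  t <= r -> padic_norm (s - a) <= r -> padic_ball t s `<=` padic_ball r a.
Proof.
move=> tr sr x xs; rewrite /padic_ball /= -(subrKA s).
by apply: le_trans (padic_normD _ _) _; rewrite ge_max (le_trans xs).
Qed.

(** The isosceles property: moving by less than the distance r to a does not
    change that distance. *)
Lemma padic_sphere_subset (p : nat) (p_pr : prime p) (a s : padic p_pr) (r t : rat) :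
  t < r -> padic_norm (s - a) = r -> padic_ball t s `<=` padic_sphere r a.
Proof.
move=> tr sr x xs; rewrite /padic_sphere /=.
have xr : padic_norm (x - s) < r := le_lt_trans xs tr.
apply/eqP; rewrite eq_le; apply/andP; split.
  apply: (@padic_ball_subset _ _ a s r t) => //; [exact: ltW | by rewrite sr].
rewrite -sr leNgt; apply/negP => ltr.
have := padic_normB (x - a) (x - s).
have -> : x - a - (x - s) = s - a by ring.
by rewrite leNgt gt_max ltr sr xr.
Qed.

Theorem theorem3 (R : realType) (p : nat) (p_pr : prime p) (a : padic p_pr)
    (m : int) :
  (forall mu : {measure set (clopen_algebra (ball_group a m)) -> \bar R},
     fin_num_fun mu ->
     (forall (s : ball_group a m) (n : int),
        padic_ball (p%:R ^ n) (val s) `<=` padic_ball (p%:R ^ m) a ->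
        mu [set x : ball_group a m | padic_ball (p%:R ^ n) (val s) (val x)] =
          (p%:R ^ n)%:E) ->
     is_haar_measure mu) /\
  (forall mu : {measure set (clopen_algebra (sphere_group a m)) -> \bar R},
     fin_num_fun mu ->
     (forall (s : sphere_group a m) (n : int),
        padic_ball (p%:R ^ n) (val s) `<=` padic_sphere (p%:R ^ m) a ->
        mu [set x : sphere_group a m | padic_ball (p%:R ^ n) (val s) (val x)] =
          (p%:R ^ n)%:E) ->
     is_haar_measure mu).
Proof.
have p_gt0 : 0 < (p%:R : rat) by rewrite ltr0n prime_gt0.
have p_gt1 : 1 < (p%:R : rat) by rewrite ltr1n prime_gt1.
split=> mu fmu muball.
- apply: (@haar_of_isometry R p p_pr _ (fun x : ball_group a m => val x) m) => //.
  + exact: initial_continuous.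
  + exact: set_type_basis.
  + move=> x y z; congr padic_norm; rewrite /=; ring.
  + move=> s n nm; apply/muball/padic_ball_subset; last exact: ball_groupP.
    by rewrite ler_weXz2l // ltW.
(* Radii stop at p^(m-1): a ball of radius p^m centred on the sphere contains
   its centre a. *)
- apply: (@haar_of_isometry R p p_pr _ (fun x : sphere_group a m => val x)
    (m - 1)) => //.
  + exact: initial_continuous.
  + exact: set_type_basis.
  (* (x . y) - (x . z) = p^m (x - a) (y - z), where p^m (x - a) has norm 1. *)
  + move=> x y z; set rp : padic p_pr := p%:R ^ m.
    have -> : val (x + y) - val (x + z) = rp * (val x - a) * (val y - val z).
      rewrite /= -/rp; ring.
    rewrite !padic_normM padic_normXp sphere_groupP mulVf ?mul1r //.
    by rewrite gt_eqF ?exprz_gt0.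
  + move=> s n nm; apply/muball/padic_sphere_subset; last exact: sphere_groupP.
    by rewrite ltr_eXz2l // -lezD1 -lerBrDr.
Qed.
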